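(* Let $(X,\tau_{\leq})$ be a compact connected linearly ordered topological space such that for every pair of elements $a<b$ in $X$ the group $H_+[a,b]$ is nontrivial. Then: (1) For $G=H_+(X)$ and for $G=H(X)$, the Zariski topology and the Markov topology of the group $G$ both coincide with the compact-open topology, that is, $\mathfrak{Z}_G=\mathfrak{M}_G=\tau_{co}$. (2) The topological groups $H_+(X)$ and $H(X)$ (with the compact-open topology) are $a$-minimal. (3) $X$ is $aM_+$-compact and $aM$-compact.
   Context: A linearly ordered topological space (LOTS) is a set with a linear order $\leq$ equipped with the order (interval) topology $\tau_\leq$, generated by the subbase of rays $\{x: x<a\}$ and $\{x: b<x\}$. All spaces are Hausdorff. For a compact space $X$, $H(X)$ denotes the group of all homeomorphisms $X\to X$ with the compact-open topology $\tau_{co}$ (a topological group). For a compact LOTS $X$, $H_+(X)$ is the subgroup of order-preserving homeomorphisms, with the subspace (compact-open) topology, also denoted $\tau_{co}$. For $a<b$ in $X$, $[a,b]=\{x: a\le x\le b\}$ is regarded as a LOTS with the inherited order, and $H_+[a,b]=H_+([a,b])$. For a group $G$ with unit $e$: the Zariski topology $\mathfrak{Z}_G$ is the topology on $G$ generated by the sub-base consisting of the sets $\{x\in G: x^{\varepsilon_1}g_1x^{\varepsilon_2}g_2\cdots x^{\varepsilon_n}g_n\neq e\}$ with $n\in\mathbb{N}$, $g_1,\dots,g_n\in G$, $\varepsilon_1,\dots,\varepsilon_n\in\{-1,1\}$. The Markov topology $\mathfrak{M}_G$ is the infimum, in the lattice of all topologies on $G$, of all Hausdorff group topologies on $G$ (i.e.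 their intersection). A Hausdorff topological group is $a$-minimal if its topology is the smallest Hausdorff group topology on the underlying group (i.e. it is contained in every Hausdorff group topology on that group). A compact space $X$ is $aM$-compact if $H(X)$ is $a$-minimal; a compact ordered space $X$ is $aM_+$-compact if $H_+(X)$ is $a$-minimal. *)

(* Defs.v *)
From HB Require Import structures.
From mathcomp Require Import all_boot all_order.
From mathcomp Require Import all_classical topology.

Set Implicit Arguments.
Unset Strict Implicit.
Unset Printing Implicit Defensive.

Import Order.TTheory.
Local Open Scope classical_set_scope.
Local Open Scope group_scope.

(* No compatibility between the group law and the topology is assumed here;
   it is part of [hausdorff_group_topology]. *)
#[short(type="preTopologicalGroupType")]
HB.structure Definition PreTopologicalGroup := {G of Topological G & Group G}.

(* [Topological G] is the type of topologies on the carrier of [G], and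
   [Topological.Pack tau] is that carrier equipped with the topology [tau]. *)
Definition hausdorff_group_topology (G : groupType) (tau : Topological G) :
    Prop :=
  let Gtau : topologicalType := Topological.Pack tau in
  [/\ hausdorff_space Gtau,
      continuous (fun xy : Gtau * Gtau => (xy.1 : G) * (xy.2 : G) : Gtau) &
      continuous (fun x : Gtau => (x : G)^-1 : Gtau)].

Definition a_minimal (G : preTopologicalGroupType) : Prop :=
  hausdorff_group_topology (Topological.class G) /\
  forall tau : Topological G, hausdorff_group_topology tau ->
    @open G `<=` @open (Topological.Pack tau).

(* The word [x^e1 * g1 * ... * x^en * gn], each pair [(b, g)] of [w] standing
   for a factor [x^e * g] with [e = 1] if [b] and [e = -1] otherwise. *)
Definition group_word (G : groupType) (w : seq (bool * G)) (x : G) : G :=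
  \prod_(p <- w) ((if p.1 then x else x^-1) * p.2).

Definition zariski (G : groupType) : Type := G.

Definition zariski_subbase (G : groupType) : set_system (zariski G) :=
  [set [set x | group_word w x <> 1] | w in [set: seq (bool * G)]].

HB.instance Definition _ (G : groupType) := Choice.on (zariski G).
HB.instance Definition _ (G : groupType) :=
  isSubBaseTopological.Build (zariski G) (@zariski_subbase G) id.

Definition markov (G : groupType) : Type := G.

Definition markov_open (G : groupType) : set_system (markov G) :=
  [set U : set G | forall tau : Topological G, hausdorff_group_topology tau ->
    @open (Topological.Pack tau) U].

Section markov_topology.
Variable G : groupType.

Let markov_openT : @markov_open G setT.
Proof. by move=> tau _; exact: openT. Qed.

Let markov_openI : setI_closed (@markov_open G).
Proof.
move=> A B oA oB tau htau.
by apply: (@openI (Topological.Pack tau)); [exact: oA|exact: oB].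
Qed.

Let markov_open_bigU (I : Type) (f : I -> set (markov G)) :
  (forall i, @markov_open G (f i)) -> @markov_open G (\bigcup_i f i).
Proof.
move=> of_ tau htau; apply: (@bigcup_open (Topological.Pack tau)) => i _.
exact: of_.
Qed.

HB.instance Definition _ := Choice.on (markov G).
HB.instance Definition _ :=
  isOpenTopological.Build (markov G) markov_openT markov_openI markov_open_bigU.

End markov_topology.

Definition homeomorphism (T U : topologicalType) (f : T -> U) : Prop :=
  continuous f /\
  exists g : U -> T, [/\ continuous g, cancel f g & cancel g f].

Definition homeo (X : topologicalType) : Type :=
  {f : X -> X | `[< homeomorphism f >]}.

Definition homeo_fun (X : topologicalType) (h : homeo X) : X -> X := val h.
Coercion homeo_fun : homeo >-> Funclass.

Section homeo_group.
Variable X : topologicalType.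
Implicit Types f g h : homeo X.

HB.instance Definition _ := SubChoice.on (homeo X).

Lemma homeoP f : homeomorphism f.
Proof. by apply/asboolP; exact: valP f. Qed.

Definition mk_homeo (u : X -> X) (hu : homeomorphism u) : homeo X :=
  exist _ u (asboolT hu).

Lemma homeo_ext f g : f =1 g -> f = g.
Proof. by move=> fg; apply/val_inj/funext. Qed.

Let homeo_inv_subproof f :
  {g : X -> X | [/\ continuous g, cancel f g & cancel g f]}.
Proof. by apply: cid; case: (homeoP f). Qed.

Let homeomorphism_inv f : homeomorphism (sval (homeo_inv_subproof f)).
Proof.
case: (homeo_inv_subproof f) => g [cg fK gK]; split=> //=.
by exists f; split=> //; case: (homeoP f).
Qed.

Definition homeo_inv f : homeo X := mk_homeo (homeomorphism_inv f).

Lemma homeo_invK f : cancel f (homeo_inv f).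
Proof. by have [_ fK _] := svalP (homeo_inv_subproof f); exact: fK. Qed.

Lemma homeo_Kinv f : cancel (homeo_inv f) f.
Proof. by have [_ _ gK] := svalP (homeo_inv_subproof f); exact: gK. Qed.

Let homeomorphism_id : homeomorphism (@id X).
Proof. by split; [|exists id; split] => // x; exact: cvg_id. Qed.

Definition homeo_id : homeo X := mk_homeo homeomorphism_id.

Let homeomorphism_comp f g : homeomorphism (f \o g).
Proof.
split.
  move=> x; apply: continuous_comp; first by case: (homeoP g) => + _; apply.
  by case: (homeoP f) => + _; apply.
exists (homeo_inv g \o homeo_inv f); split.
- move=> x; apply: continuous_comp.
    by case: (homeoP (homeo_inv f)) => + _; apply.
  by case: (homeoP (homeo_inv g)) => + _; apply.
- by apply: can_comp; exact: homeo_invK.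
- by apply: can_comp; exact: homeo_Kinv.
Qed.

Definition homeo_comp f g : homeo X := mk_homeo (homeomorphism_comp f g).

Let homeo_compA : associative homeo_comp.
Proof. by move=> f g h; exact: homeo_ext. Qed.

Let homeo_id_comp : left_id homeo_id homeo_comp.
Proof. by move=> f; exact: homeo_ext. Qed.

Let homeo_comp_id : right_id homeo_id homeo_comp.
Proof. by move=> f; exact: homeo_ext. Qed.

Let homeo_inv_comp : left_inverse homeo_id homeo_inv homeo_comp.
Proof. by move=> f; apply: homeo_ext => x; exact: homeo_invK. Qed.

Let homeo_comp_inv : right_inverse homeo_id homeo_inv homeo_comp.
Proof. by move=> f; apply: homeo_ext => x; exact: homeo_Kinv. Qed.

HB.instance Definition _ := isGroup.Build (homeo X)
  homeo_compA homeo_id_comp homeo_comp_id homeo_inv_comp homeo_comp_inv.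

HB.instance Definition _ := Topological.copy (homeo X)
  (initial_topology (@homeo_fun X : homeo X -> {compact-open, X -> X})).

End homeo_group.

Section ohomeo_group.
Context {d : Order.disp_t} (X : orderTopologicalType d).

Definition order_preserving : pred (homeo X) :=
  fun h => `[< {homo h : x y / (x <= y)%O} >].

Lemma order_preserving_group_closed : group_closed order_preserving.
Proof.
split; first by apply/asboolP => x y.
move=> f g /asboolP f_homo /asboolP g_homo; apply/asboolP => x y xy.
apply: f_homo; change ((homeo_inv g x <= homeo_inv g y)%O).
have [//|lt_yx] := leP (homeo_inv g x) (homeo_inv g y).
have := g_homo _ _ (ltW lt_yx); rewrite !homeo_Kinv => yx.
by move: lt_yx; rewrite (@le_anti _ _ x y) ?ltxx// xy yx.
Qed.

Definition ohomeo : Type := {h : homeo X | order_preserving h}.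

Definition ohomeo_val (h : ohomeo) : homeo X := val h.
Coercion ohomeo_val : ohomeo >-> homeo.

HB.instance Definition _ := SubChoice.on ohomeo.
HB.instance Definition _ := SubChoice_isSubGroup.Build
  (homeo X) order_preserving ohomeo order_preserving_group_closed.

HB.instance Definition _ := Topological.copy ohomeo
  (initial_topology ohomeo_val).

End ohomeo_group.

Section closed_interval.
Context {d : Order.disp_t} {X : orderType d} (a b : X).

Definition closed_itv : Type := {x : X | (a <= x <= b)%O}.

HB.instance Definition _ := SubChoice.on closed_itv.
HB.instance Definition _ := [SubChoice_isSubOrder of closed_itv by <: with d].

End closed_interval.

Definition aM_compact (X : topologicalType) : Prop :=
  [/\ hausdorff_space X, compact [set: X] & a_minimal (homeo X)].

Definition aMplus_compact (d : Order.disp_t) (X : orderTopologicalType d) :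
    Prop :=
  compact [set: X] /\ a_minimal (ohomeo X).

(* Main.v *)
(* Zariski is coarser than Markov, which is coarser than the compact-open
   topology, so it suffices that the Zariski topology refines the compact-open
   one. If [h] and [g] are supported in [(a, b)] and do not commute, then the
   Zariski neighbourhood [{y | y h y^-1 g <> g y h y^-1}] of the unit consists
   of maps [y] for which [y (a, b)] meets [(a, b)]. Doing this for two adjacent
   intervals [(a, c)] and [(c, b)] forces [y], which is monotone since [X] is
   connected, to be increasing with [y a < b] and [a < y b]. By compactness such
   neighbourhoods control the images of compact sets. *)
Require Import Defs.
From mathcomp Require Import all_boot all_order interval.
From mathcomp Require Import all_classical topology.
Local Open Scope classical_set_scope.

Set Implicit Arguments.
Unset Strict Implicit.
Unset Printing Implicit Defensive.

Import Order.TTheory.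

Section homeo_topology.
Local Open Scope group_scope.
Variable X : topologicalType.
Implicit Types f g : homeo X.

Lemma homeo_continuous f : continuous f.
Proof. by have [] := homeoP f. Qed.

Lemma homeoVK f : cancel f (f^-1 : homeo X)%g.
Proof. exact: homeo_invK. Qed.

Lemma homeoKV f : cancel (f^-1 : homeo X)%g f.
Proof. exact: homeo_Kinv. Qed.

Lemma homeo_cvgP (F : set_system (homeo X)) f : Filter F ->
  F --> f <-> forall (K O : set X), compact K -> open O ->
    (forall k, K k -> O (f k)) ->
    \forall g \near F, forall k, K k -> O ((g : homeo X) k).
Proof.
move=> FF.
have cfun : continuous (@homeo_fun X : homeo X -> {compact-open, X -> X}).
  exact: initial_continuous.
split=> [Ff K O cK oO fKO|Fco].
  have: (@homeo_fun X : homeo X -> {compact-open, X -> X}) @ F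
    --> (homeo_fun f : {compact-open, X -> X}).
    exact: cvg_trans (cvg_app _ Ff) (cfun f).
  move/compact_open_cvgP => /(_ K O cK oO) h.
  have : homeo_fun f @` K `<=` O by move=> _ [k Kk <-]; exact: fKO.
  move=> /h; apply: (@filterS _ F) => g gKO k Kk.
  by apply: gKO; exists k.
move=> U; rewrite nbhsE => -[_ [[V oV <-] Vf] VU].
apply: (@filterS _ F _ _ _ VU).
suff /(_ V) : (@homeo_fun X : homeo X -> {compact-open, X -> X}) @ F
    --> (homeo_fun f : {compact-open, X -> X}) by apply; exact: open_nbhs_nbhs.
apply/compact_open_cvgP => K O cK oO fKO.
have := Fco K O cK oO (fun k Kk => fKO _ (imageP _ Kk)).
by apply: (@filterS _ F) => g gKO _ [k Kk <-]; exact: gKO.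
Qed.

Hypothesis X_hausdorff : hausdorff_space X.
Hypothesis X_compact : compact [set: X].

Lemma compact_set_closed (A : set X) : closed A -> compact A.
Proof. by move=> cA; apply: subclosed_compact cA X_compact _. Qed.

Lemma homeo_eval_continuous :
  continuous (fun fx : homeo X * X => (fx.1 : homeo X) fx.2).
Proof.
move=> [f x] O /= Ofx.
have [V oVfx VO] : exists2 V, open_nbhs ((f : homeo X) x) V & V `<=` O.
  by rewrite nbhsE in Ofx.
have [oV Vfx] := oVfx.
have [C Cx CV] : filter_from (nbhs x) closure ((f : homeo X) @^-1` V).
  apply: (compact_regular X_hausdorff X_compact); first exact: filterT.
  by apply: homeo_continuous; exact: open_nbhs_nbhs.
have nf : \forall g \near f, forall k, closure C k -> V ((g : homeo X) k).
  have /homeo_cvgP : nbhs f --> f by exact: cvg_id.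
  by apply => //; apply: compact_set_closed; exact: closed_closure.
change (\forall gy \near (f, x), O ((gy.1 : homeo X) gy.2)).
near=> gy; apply: VO.
have : closure C gy.2.
  apply: subset_closure; near: gy; exact: cvg_snd.
have : forall k, closure C k -> V ((gy.1 : homeo X) k).
  by near: gy; exact: cvg_fst nf.
exact.
Unshelve. all: by end_near. Qed.

Lemma homeo_mul_continuous :
  continuous (fun fg : homeo X * homeo X => fg.1 * fg.2).
Proof.
move=> [f g]; apply/homeo_cvgP => K O /compact_near_coveringP Kcov oO fgKO.
pose P (p : homeo X * homeo X) k := O ((p.1 * p.2 : homeo X) k).
apply: (Kcov _ (nbhs (f, g)) P) => k Kk.
have Ofgk : nbhs ((f : homeo X) ((g : homeo X) k)) O.
  by apply: open_nbhs_nbhs; split=> //; exact: fgKO.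
have [[A B] [Af Bgk] ABO] := @homeo_eval_continuous (_, _) _ Ofgk.
have [[C D] [Cg Dk] CDB] := @homeo_eval_continuous (_, _) _ Bgk.
exists (D, A `*` C); first by split=> //; exists (A, C).
case=> y [u v] [Dy [Au Cv]].
exact: (ABO (u, (v : homeo X) y) (conj Au (CDB (v, y) (conj Cv Dy)))).
Qed.

Lemma homeo_inv_continuous : continuous (fun f : homeo X => f^-1).
Proof.
move=> f; apply/homeo_cvgP.
  by apply: fmap_filter; exact: nbhs_filter.
move=> K O cK oO fKO.
have cO : compact (~` O) by apply: compact_set_closed; exact: open_closedC.
have oK : open (~` K) by apply: closed_openC; exact: compact_closed.
have : \forall g \near f, forall k, (~` O) k -> (~` K) ((g : homeo X) k).
  have /homeo_cvgP : nbhs f --> f by exact: cvg_id.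
  by apply => // k Ok Kfk; apply: Ok; rewrite -(homeoVK f k); exact: fKO.
apply: filterS => g gOK k Kk; apply: contrapT => /gOK; apply.
by rewrite homeoKV.
Qed.

Lemma homeo_hausdorff : hausdorff_space (homeo X).
Proof.
move=> f g fg; apply: homeo_ext => x; apply: X_hausdorff => A B Af Bg.
have ev h : continuous_at h (fun u : homeo X => u x).
  move=> U Uh.
  have [[A' B'] [A'h B'x] ABU] := @homeo_eval_continuous (_, _) _ Uh.
  apply: filterS A'h => u A'u.
  exact: (ABU ((u : homeo X), x) (conj A'u (nbhs_singleton B'x))).
by have [u [Au Bu]] := fg _ _ (ev f A Af) (ev g B Bg); exists ((u : homeo X) x).
Qed.

Lemma homeo_group_topology :
  hausdorff_group_topology (Topological.class (homeo X)).
Proof.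
split; [exact: homeo_hausdorff|exact: homeo_mul_continuous|].
exact: homeo_inv_continuous.
Qed.

End homeo_topology.

Section zariski_markov.
Local Open Scope group_scope.
Variable G : groupType.

Lemma zariski_open_word (w : seq (bool * G)) :
  open ([set x | group_word w x <> 1] : set (zariski G)).
Proof.
set C := [set x | _]; exists [set C]; last by rewrite bigcup_set1.
by move=> _ ->; apply: (@finI_from1 _ _ (@zariski_subbase G) id C); exists w.
Qed.

Lemma group_word_continuous (tau : Topological G) (w : seq (bool * G)) :
  hausdorff_group_topology tau ->
  continuous (group_word w : Topological.Pack tau -> Topological.Pack tau).
Proof.
move=> [_ mulc invc].
have mulfc (f g : Topological.Pack tau -> Topological.Pack tau) :
    continuous f -> continuous g ->
    continuous (fun x => (f x : G) * (g x : G) : Topological.Pack tau).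
  move=> fc gc x.
  exact: continuous2_cvg (mulc (f x, g x)) (fc x) (gc x).
elim: w => [|[b g] w IH].
  rewrite (_ : group_word [::] = cst 1); first exact: cst_continuous.
  by apply/funext => x; rewrite /group_word big_nil.
rewrite (_ : group_word _ =
    fun x => (if b then x else x^-1) * g * group_word w x); last first.
  by apply/funext => x; rewrite /group_word big_cons.
apply: (mulfc _ _ _ IH); apply: (mulfc); last exact: cst_continuous.
by case: b => //= x; exact: cvg_id.
Qed.

Lemma zariski_sub_markov : @open (zariski G) `<=` @open (markov G).
Proof.
move=> U [D' D'fin <-]; change (markov_open (\bigcup_(V in D') (V : set G))).
move=> tau htau; have [T2 _ _] := htau.
apply: (@bigcup_open (Topological.Pack tau)) => V /D'fin[F Fsub <-].
rewrite openE => x Fx; apply: filter_bigI => W WF.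
apply: open_nbhs_nbhs; split; last exact: Fx.
have /set_mem [w _ <-] := Fsub _ WF.
have cl1 : closed ([set 1] : set (Topological.Pack tau)).
  exact: accessible_closed_set1 (hausdorff_accessible T2) _.
have := closed_openC cl1.
by move/continuousP : (@group_word_continuous tau w htau); apply.
Qed.

End zariski_markov.

Section ohomeo_topology.
Local Open Scope group_scope.
Context {d : Order.disp_t} (X : orderTopologicalType d).
Hypothesis X_compact : compact [set: X].

Lemma ohomeo_val_continuous : continuous (@ohomeo_val d X).
Proof. exact: initial_continuous. Qed.

Lemma ohomeo_group_topology :
  hausdorff_group_topology (Topological.class (ohomeo X)).
Proof.
have [T2 mulc invc] := homeo_group_topology (@order_hausdorff _ X) X_compact.
split.
- move=> f g fg; apply/val_inj/T2 => A B Af Bg.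
  have [h [Ah Bh]] :=
    fg _ _ (ohomeo_val_continuous Af) (ohomeo_val_continuous Bg).
  by exists (ohomeo_val h).
- apply: continuous_comp_initial => -[f g].
  have cf : (fun p : ohomeo X * ohomeo X => ohomeo_val p.1) @ nbhs (f, g)
    --> ohomeo_val f.
    move=> A /ohomeo_val_continuous Af.
    exact: (@cvg_fst _ _ (nbhs f) (nbhs g) _ _ Af).
  have cg : (fun p : ohomeo X * ohomeo X => ohomeo_val p.2) @ nbhs (f, g)
    --> ohomeo_val g.
    move=> A /ohomeo_val_continuous Ag.
    exact: (@cvg_snd _ _ (nbhs f) (nbhs g) _ _ Ag).
  exact: continuous2_cvg (mulc (ohomeo_val f, ohomeo_val g)) cf cg.
- apply: continuous_comp_initial => f.
  apply: (@continuous_comp _ _ _ (@ohomeo_val d X) (fun f : homeo X => f^-1)).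
    exact: ohomeo_val_continuous.
  exact: invc.
Qed.
End ohomeo_topology.

Section lots.
Local Open Scope order_scope.
Local Open Scope classical_set_scope.
Context {d : Order.disp_t} (X : orderTopologicalType d).
Implicit Types (a b c x y t : X) (U V : set X).

Lemma open_lt a : open [set x | x < a].
Proof. by rewrite -set_itvE; exact: lray_open. Qed.

Lemma open_gt a : open [set x | a < x].
Proof. by rewrite -set_itvE; exact: rray_open. Qed.

Lemma lots_cvg (F : set_system X) x : Filter F ->
  (forall a, a < x -> F [set y | a < y]) ->
  (forall b, x < b -> F [set y | y < b]) -> F --> x.
Proof.
move=> FF Fgt Flt U; rewrite itv_nbhsE => -[[l r] [olr xlr] lrU].
apply: (filterS lrU); move: olr xlr; rewrite itv_boundlr => olr /andP[lx xr].
have -> : [set` Interval l r] =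
    [set y | (l <= BLeft y)%O] `&` [set y | (BRight y <= r)%O].
  by apply/seteqP; split=> y /=; rewrite itv_boundlr => /andP.
apply: filterI.
  case: l olr lx {lrU} => [[] l|[] _ ?].
  - by move=> /itv_open_ends_lside.
  - move=> _; rewrite bnd_simp => /Fgt; apply: filterS => y /=.
    by rewrite bnd_simp.
  - by apply: filterS filterT.
  - by [].
case: r olr xr {lrU} => [[] r|[] _ ?].
- move=> _; rewrite bnd_simp => /Flt; apply: filterS => y /=.
  by rewrite bnd_simp.
- by move=> /itv_open_ends_rside.
- by [].
- by apply: filterS filterT.
Qed.

Lemma order_iso_homeomorphism (f g : X -> X) : cancel f g -> cancel g f ->
  {homo f : x y / x <= y} -> homeomorphism f.
Proof.
have main (u v : X -> X) : cancel u v -> cancel v u ->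
    {homo u : x y / x < y} -> continuous u.
  move=> uK vK u_lt x; apply: lots_cvg => c.
    move=> cx; apply: open_nbhs_nbhs; split; last exact: cx.
    rewrite (_ : _ @^-1` _ = [set y | v c < y]); first exact: open_gt.
    apply/seteqP; split=> y /=; last by move/u_lt; rewrite vK.
    move=> cy; rewrite ltNge; apply/negP.
    rewrite le_eqVlt => /orP[/eqP yE|/u_lt].
      by move: cy; rewrite yE vK ltxx.
    by rewrite vK => /(lt_trans cy); rewrite ltxx.
  move=> xc; apply: open_nbhs_nbhs; split; last exact: xc.
  rewrite (_ : _ @^-1` _ = [set y | y < v c]); first exact: open_lt.
  apply/seteqP; split=> y /=; last by move/u_lt; rewrite vK.
  move=> yc; rewrite ltNge; apply/negP; rewrite le_eqVlt => /orP[/eqP yE|/u_lt].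
    by move: yc; rewrite -yE vK ltxx.
  by rewrite vK => /(lt_trans yc); rewrite ltxx.
move=> fK gK f_le.
have f_lt : {homo f : x y / x < y}.
  by move=> x y xy; rewrite lt_neqAle (can_eq fK) (lt_eqF xy) f_le// ltW.
have g_lt : {homo g : x y / x < y}.
  move=> x y xy; rewrite ltNge; apply/negP => /f_le; rewrite !gK.
  by move=> /(lt_le_trans xy); rewrite ltxx.
split; first exact: main fK gK f_lt.
by exists g; split=> //; exact: main gK fK g_lt.
Qed.

Hypothesis X_connected : connected [set: X].

Lemma connected_open_meet U V : open U -> open V -> U `|` V = setT ->
  U !=set0 -> V !=set0 -> U `&` V !=set0.
Proof.
move=> oU oV UV U0 [v Vv]; apply: contrapT => UV0.
have UE : U = ~` V.
  apply/seteqP; split=> [x Ux Vx|x nVx]; first by apply: UV0; exists x.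
  by have : [set: X] x by []; rewrite -UV => -[].
have : U = setT.
  apply: X_connected => //; first by exists U => //; rewrite setTI.
  by exists U; rewrite ?setTI// UE; exact: open_closedC.
by move/seteqP => [_ /(_ v I)]; rewrite UE; exact.
Qed.

Lemma lots_dense a b : a < b -> exists c, a < c < b.
Proof.
move=> ab.
have [] := connected_open_meet (open_lt b) (open_gt a).
- apply/seteqP; split=> // x _ /=; have [xb|bx] := ltP x b; [by left|right].
  exact: lt_le_trans bx.
- by exists a.
- by exists b.
by move=> c [/= cb ac]; exists c; rewrite ac.
Qed.

(* Otherwise the open sets [x < a \/ x < b /\ U x] and [b < x \/ a < x /\ V x]
   would disconnect [X]. *)
Lemma lots_separation_point U V a b : open U -> open V -> U `&` V = set0 ->
  a < b -> U a -> V b -> exists t, [/\ a < t < b, ~ U t & ~ V t].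
Proof.
move=> oU oV UV ab Ua Vb; apply: contrapT => nt.
pose U' := [set x | x < a] `|` ([set x | x < b] `&` U).
pose V' := [set x | b < x] `|` ([set x | a < x] `&` V).
have [] := @connected_open_meet U' V'.
- by apply: openU; [exact: open_lt|apply: openI => //; exact: open_lt].
- by apply: openU; [exact: open_gt|apply: openI => //; exact: open_gt].
- apply/seteqP; split=> // x _; rewrite /U' /V' /=.
  have [xa|ax|->] := ltgtP x a; [by left; left| |by left; right].
  have [xb|bx|->] := ltgtP x b; [|by right; left|by right; right].
  apply: contrapT => nUV; apply: nt; exists x; split; first by rewrite ax.
    by move=> Ux; apply: nUV; left; right.
  by move=> Vx; apply: nUV; right; right.
- by exists a; right.
- by exists b; right.
move=> x [[/= xa|[/= xb Ux]] [/= bx|[/= ax Vx]]].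
- by have := lt_trans (lt_trans xa ab) bx; rewrite ltxx.
- by have := lt_trans xa ax; rewrite ltxx.
- by have := lt_trans xb bx; rewrite ltxx.
- by have : set0 x; [rewrite -UV|].
Qed.

Section monotone.
Variable f : X -> X.
Hypotheses (f_cont : continuous f) (f_inj : injective f).

Let ivt_aux a b t : a < b ->
  (f a < f t < f b) || (f b < f t < f a) -> a < t < b.
Proof.
move=> ab.
have oU : open (f @^-1` [set x | x < f t]).
  by move/continuousP : f_cont; apply; exact: open_lt.
have oV : open (f @^-1` [set x | f t < x]).
  by move/continuousP : f_cont; apply; exact: open_gt.
have UV : f @^-1` [set x | x < f t] `&` f @^-1` [set x | f t < x] = set0.
  apply/seteqP; split=> // x [/= xt tx].
  by have := lt_trans xt tx; rewrite ltxx.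
have fin x : ~ (f x < f t) -> ~ (f t < f x) -> x = t.
  by move=> /negP + /negP; rewrite -!leNgt => tx xt; apply/f_inj/le_anti/andP.
case/orP=> /andP[H1 H2].
  have [x [xab Ux Vx]] := lots_separation_point oU oV UV ab H1 H2.
  by rewrite -(fin x Ux Vx).
rewrite setIC in UV.
have [x [xab Vx Ux]] := lots_separation_point oV oU UV ab H2 H1.
by rewrite -(fin x Ux Vx).
Qed.

Let between a b c : a < b -> b < c ->
  (f a < f b < f c) || (f c < f b < f a).
Proof.
move=> ab bc; have ac := lt_trans ab bc.
have fne x y : x < y -> f x != f y by move=> xy; rewrite (inj_eq f_inj) lt_eqF.
have nc := @ivt_aux a b c ab; have na := @ivt_aux b c a bc.
rewrite (ltNge c) (ltW bc) andbF in nc.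
rewrite (ltNge b) (ltW ab) /= in na.
move: nc na (fne _ _ ab) (fne _ _ bc) (fne _ _ ac).
by case: (ltgtP (f a) (f b)) => //; case: (ltgtP (f b) (f c)) => //;
   case: (ltgtP (f a) (f c)) => //= _ _ _ nc na.
all: first [by have := nc isT|by have := na isT].
Qed.

Let dir_r a b c : a < b -> b <= c -> (f a < f c) = (f a < f b).
Proof.
move=> ab; rewrite le_eqVlt => /orP[/eqP->//|bc].
case/orP: (between ab bc) => /andP[H1 H2].
  by rewrite (lt_trans H1 H2) H1.
by rewrite !ltNge (ltW H2) (ltW (lt_trans H1 H2)).
Qed.

Let dir_l a b c : a <= b -> b < c -> (f a < f c) = (f b < f c).
Proof.
rewrite le_eqVlt => /orP[/eqP->//|ab] bc.
case/orP: (between ab bc) => /andP[H1 H2].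
  by rewrite (lt_trans H1 H2) H2.
by rewrite !ltNge (ltW H1) (ltW (lt_trans H1 H2)).
Qed.

Lemma injective_continuous_homo a b : a < b -> f a < f b ->
  {homo f : x y / x < y}.
Proof.
move=> ab fab x y xy.
pose m := Order.min a x; pose M := Order.max b y.
have ma : m <= a by rewrite ge_min lexx.
have mx : m <= x by rewrite ge_min lexx orbT.
have bM : b <= M by rewrite le_max lexx.
have yM : y <= M by rewrite le_max lexx orbT.
rewrite -(dir_l mx xy) -(dir_r (le_lt_trans mx xy) yM).
by rewrite (dir_r (le_lt_trans ma ab) bM) (dir_l ma ab).
Qed.

End monotone.
End lots.

Section extension.
Local Open Scope order_scope.
Context {d : Order.disp_t} (X : orderTopologicalType d) (a b : X).
Local Notation Y := (order_topology (closed_itv a b)).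
Implicit Types h g : homeo Y.

Definition itv_extension h (x : X) : X :=
  if insub x is Some y then val ((h : Y -> Y) y : closed_itv a b) else x.

Lemma itv_extension_val h (y : closed_itv a b) :
  itv_extension h (val y) = val ((h : Y -> Y) y : closed_itv a b).
Proof. by rewrite /itv_extension valK. Qed.

Lemma itv_extension_out h x : ~~ (a <= x <= b) -> itv_extension h x = x.
Proof. by rewrite /itv_extension => nx; rewrite insubN. Qed.

Lemma itv_extensionP h x :
  (exists2 y : closed_itv a b, x = val y &
     itv_extension h x = val ((h : Y -> Y) y : closed_itv a b)) \/
  ~~ (a <= x <= b) /\ itv_extension h x = x.
Proof.
have [xab|nx] := boolP (a <= x <= b); [left|right].
  by exists (Sub x xab); rewrite -?itv_extension_val SubK.
by rewrite itv_extension_out.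
Qed.

Lemma itv_extension_cancel h g : cancel h g ->
  cancel (itv_extension h) (itv_extension g).
Proof.
move=> hK x; case: (itv_extensionP h x) => [[y -> ->]|[nx ->]].
  by rewrite itv_extension_val hK.
exact: itv_extension_out.
Qed.

Lemma itv_extension_homo h : order_preserving h ->
  {homo itv_extension h : x y / x <= y}.
Proof.
move=> /asboolP h_le x y.
case: (itv_extensionP h x) => [[u -> ->]|[nx ->]];
  case: (itv_extensionP h y) => [[v -> ->]|[ny ->]] //.
- by move=> uv; have := h_le _ _ (uv : (u : Y) <= v).
- have /andP[au ub] := valP u.
  have /andP[_ hb] := valP ((h : Y -> Y) u : closed_itv a b).
  move=> uy; move: ny; rewrite (le_trans au uy) /= -ltNge => /ltW.
  exact: le_trans.
- have /andP[av vb] := valP v.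
  have /andP[ha _] := valP ((h : Y -> Y) v : closed_itv a b).
  move=> xv; move: nx; rewrite (le_trans xv vb) andbT -ltNge => /ltW ax.
  exact: le_trans ha.
Qed.

End extension.

Section supports.
Local Open Scope order_scope.
Context {d : Order.disp_t} (X : orderTopologicalType d).
Implicit Types (f g h u v : homeo X) (a b c s t x y z : X).

Definition supported_in a b h : Prop := forall x, h x <> x -> a < x < b.

Lemma homeo_mulE u v x : (u * v : homeo X)%g x = u (v x).
Proof. by []. Qed.

Lemma homeo_inj u : injective u.
Proof. exact: can_inj (homeoVK u). Qed.

Lemma disjoint_supports_commute u v :
  (forall x, u x = x \/ v x = x) -> (u * v = v * u)%g.
Proof.
move=> uv; apply: homeo_ext => x; rewrite !homeo_mulE.
have [ux|ux] := pselect (u x = x).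
  have [vx|vx] := pselect (v x = x); first by rewrite vx ux vx.
  by rewrite ux; case: (uv (v x)) => // /homeo_inj.
have vx : v x = x by case: (uv x).
by rewrite vx; case: (uv (u x)) => // /homeo_inj.
Qed.

Lemma noncommuting_conj_overlap a b h g (y : homeo X) :
  supported_in a b h -> supported_in a b g ->
  (y * h * y^-1 * g)%g <> (g * (y * h * y^-1))%g ->
  exists z, a < z < b /\ a < y z < b.
Proof.
move=> sh sg ncom; apply: contrapT => nz; apply: ncom.
apply: disjoint_supports_commute => x; apply: contrapT => /not_orP[hx gx].
apply: nz; exists ((y^-1 : homeo X)%g x); rewrite homeoKV.
split; last exact: sg.
by apply: sh => hE; apply: hx; rewrite !homeo_mulE hE homeoKV.
Qed.

Hypothesis X_connected : connected [set: X].
Hypothesis H_itv_nontrivial : forall a b : X, a < b ->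
  exists h : ohomeo (order_topology (closed_itv a b)), h <> 1%g.

Lemma exists_supported a b : a < b -> exists h,
  [/\ order_preserving h, supported_in a b h & h <> 1%g].
Proof.
move=> ab; have [a' /andP[aa' a'b]] := lots_dense X_connected ab.
have [b' /andP[a'b' b'b]] := lots_dense X_connected a'b.
have [h h1] := H_itv_nontrivial a'b'.
pose k := itv_extension h.
have kK : cancel k (itv_extension (h : homeo _)^-1%g).
  by apply: itv_extension_cancel; exact: homeoVK.
have Kk : cancel (itv_extension (h : homeo _)^-1%g) k.
  by apply: itv_extension_cancel; exact: homeoKV.
have k_le : {homo k : x y / x <= y}.
  by apply: itv_extension_homo; exact: (valP h).
exists (mk_homeo (order_iso_homeomorphism kK Kk k_le)); split.
- exact/asboolP.
- move=> x /= kx; suff /andP[ax xb] : a' <= x <= b'.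
    by rewrite (lt_le_trans aa' ax) (le_lt_trans xb b'b).
  by apply/negP => /negP nx; apply: kx; exact: itv_extension_out.
- move=> k1; apply: h1; apply/val_inj/homeo_ext => y.
  apply/val_inj; rewrite /= -itv_extension_val.
  by have := congr1 (fun u : homeo X => u (val y)) k1.
Qed.

Lemma exists_noncommuting a b : a < b -> exists h g,
  [/\ order_preserving h /\ order_preserving g,
      supported_in a b h, supported_in a b g & (h * g <> g * h)%g].
Proof.
move=> ab; have [f [f_le sf f1]] := exists_supported ab.
have [t ft] : exists t, f t <> t.
  by apply: contrapT => /forallNP fE; apply: f1; apply: homeo_ext => x;
     have /contrapT := fE x.
have f_lt : {homo f : x y / x < y}.
  move=> x y xy; rewrite lt_neqAle (inj_eq (@homeo_inj f)) (lt_eqF xy) /=.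
  by move/asboolP : f_le; apply; exact: ltW.
have /andP[at_ tb] := sf _ ft.
have /andP[aft ftb] : a < f t < b by apply: sf => /homeo_inj.
have [u [v [uv au vb fuv]]] : exists u v : X, [/\ u < v, a < u, v < b &
    forall x, u < x < v -> ~~ (u < f x < v)].
  move/eqP : ft; rewrite neq_lt => /orP[ftt|tft].
    have [s /andP[fts st]] := lots_dense X_connected ftt.
    exists s, t; split=> //; first exact: lt_trans fts.
    move=> x /andP[_ /f_lt xt]; rewrite negb_and -leNgt.
    by rewrite (ltW (lt_trans xt fts)).
  have [s /andP[ts sft]] := lots_dense X_connected tft.
  exists t, s; split=> //; first exact: lt_trans ftb.
  move=> x /andP[/f_lt tx _]; rewrite negb_and -!leNgt.
  by rewrite (ltW (lt_trans sft tx)) orbT.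
have [g [g_le sg g1]] := exists_supported uv.
exists f, g; split=> //.
  move=> x /sg /andP[ux xv].
  by rewrite (lt_trans au ux) (lt_trans xv vb).
move=> fg; apply: g1; apply: homeo_ext => y; apply: contrapT => gy.
have := congr1 (fun k : homeo X => k y) fg; rewrite !homeo_mulE.
have -> : g (f y) = f y.
  by apply: contrapT => /sg; apply/negP/fuv; exact: sg.
by move/homeo_inj.
Qed.

End supports.

Section noncommuting.
Local Open Scope group_scope.

Lemma zariski_open_noncommuting (G : groupType) (x0 h g : G) :
  open ([set x | let y := (x0^-1 * x)%g in
    (y * h * y^-1 * g <> g * (y * h * y^-1))%g] : set (zariski G)).
Proof.
pose w := [:: (true, h); (false, x0 * g * x0^-1);
              (true, h^-1); (false, x0 * g^-1 * x0^-1)].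
rewrite (_ : [set x | _] = [set x | group_word w x <> 1]).
  exact: zariski_open_word.
have wE y : group_word w (x0 * y) =
    x0 * (y * h * y^-1 * g * (g * (y * h * y^-1))^-1) * x0^-1.
  rewrite /group_word /w !big_cons big_nil /= !(invgM, invgK) !mulgA !mulg1.
  by rewrite !mulgVK.
apply/seteqP; split=> x /=; have := wE (x0^-1 * x); rewrite mulVKg => ->.
  move=> nc w1; apply: nc; apply/divg1_eq.
  by apply: (@mulgI _ x0); apply: (@mulIg _ x0^-1); rewrite w1 mulg1 mulgV.
move=> nw c; apply: nw; by rewrite c mulgV mulg1 mulgV.
Qed.

End noncommuting.

Section coarser.
Local Open Scope order_scope.
Local Open Scope classical_set_scope.
Context {d : Order.disp_t} (X : orderTopologicalType d).
Hypothesis X_connected : connected [set: X].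
Hypothesis H_itv_nontrivial : forall a b : X, a < b ->
  exists h : ohomeo (order_topology (closed_itv a b)), h <> 1%g.
Variables (G : groupType) (phi : G -> homeo X).
Hypothesis phiM : {morph phi : x y / (x * y)%g >-> (x * y)%g}.
Hypothesis phi_inj : injective phi.
Hypothesis phi_ohomeo : forall h : homeo X, order_preserving h ->
  exists x, phi x = h.

Let phiV x : phi x^-1%g = ((phi x)^-1)%g.
Proof.
have phi1 : phi 1%g = 1%g.
  by apply: (@mulgI _ (phi 1%g)); rewrite -phiM !mulg1.
by apply: (@mulgI _ (phi x)); rewrite -phiM !mulgV.
Qed.

Lemma zariski_near_overlap (x0 : G) (a b : X) : a < b ->
  \forall x \near (x0 : zariski G),
    exists z, a < z < b /\ a < phi (x0^-1 * x)%g z < b.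
Proof.
move=> ab.
have [h [g [[h_le g_le] sh sg hg]]] :=
  exists_noncommuting X_connected H_itv_nontrivial ab.
have [h' hE] := phi_ohomeo h_le; have [g' gE] := phi_ohomeo g_le.
have oW := zariski_open_noncommuting x0 h' g'.
apply: filterS (open_nbhs_nbhs (conj oW _)).
  move=> x /=; move: (x0^-1 * x)%g => y nc.
  apply: noncommuting_conj_overlap sh sg _ => c; apply: nc.
  by apply: phi_inj; rewrite !phiM phiV hE gE.
rewrite /= mulVg mul1g invg1 mulg1 => c; apply: hg.
by rewrite -hE -gE -!phiM c.
Qed.

Lemma zariski_near_increasing (x0 : G) (a b : X) : a < b ->
  \forall x \near (x0 : zariski G), let y := phi (x0^-1 * x)%g in
    [/\ {homo y : s t / s <= t}, y a < b & a < y b].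
Proof.
move=> ab; have [c /andP[ac cb]] := lots_dense X_connected ab.
apply: filterS2 _ (zariski_near_overlap x0 ac) (zariski_near_overlap x0 cb).
move=> x; move: (phi _) => y [s [/andP[as_ sc] /andP[ays ysc]]].
move=> [t [/andP[ct tb] /andP[cyt ytb]]].
have y_lt : {homo y : u v / u < v}.
  apply: (injective_continuous_homo X_connected (@homeo_continuous _ y)
    (@homeo_inj _ _ y) (lt_trans sc ct)).
  exact: lt_trans cyt.
split; first exact: ltW_homo.
- exact: lt_trans (lt_trans (y_lt _ _ as_) ysc) cb.
- exact: lt_trans (lt_trans ac cyt) (y_lt _ _ tb).
Qed.

Lemma zariski_finer_compact_open : continuous (phi : zariski G -> homeo X).
Proof.
move=> x0; apply/homeo_cvgP.
  by apply: fmap_filter; exact: nbhs_filter.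
move=> K O /compact_near_coveringP Kcov oO x0KO.
pose P (x : zariski G) k := O (phi x k).
apply: (Kcov _ (nbhs (x0 : zariski G)) P) => k Kk.
pose O' := phi x0 @^-1` O.
have O'k : nbhs k O'.
  by apply: homeo_continuous; apply: open_nbhs_nbhs; split=> //; exact: x0KO.
have : (fun q : X * zariski G => phi (x0^-1 * q.2)%g q.1)
    @ nbhs (k, (x0 : zariski G)) --> k.
  apply: lots_cvg => c.
    move=> /[dup] ck /(lots_dense X_connected)[m /andP[cm mk]].
    exists ([set y | m < y], [set x | let y := phi (x0^-1 * x)%g in
      [/\ {homo y : s t / s <= t}, y c < m & c < y m]]); first split.
    - by apply: open_nbhs_nbhs; split => //; exact: open_gt.
    - exact: zariski_near_increasing.
    case=> y x [/= my [x_le _ cxm]].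
    by apply: lt_le_trans cxm _; apply: x_le; exact: ltW.
  move=> /[dup] kc /(lots_dense X_connected)[m /andP[km mc]].
  exists ([set y | y < m], [set x | let y := phi (x0^-1 * x)%g in
    [/\ {homo y : s t / s <= t}, y m < c & m < y c]]); first split.
  - by apply: open_nbhs_nbhs; split => //; exact: open_lt.
  - exact: zariski_near_increasing.
  case=> y x [/= ym [x_le xmc _]].
  by apply: le_lt_trans xmc; apply: x_le; exact: ltW.
have PO (q : X * zariski G) : O' (phi (x0^-1 * q.2)%g q.1) -> P q.2 q.1.
  by rewrite /O' /P /= -homeo_mulE -phiM mulVKg.
move=> /(_ _ O'k) cvk.
exact: (@filterS _ (nbhs (k, (x0 : zariski G))) _ _ _ PO cvk).
Qed.

End coarser.

Lemma markov_sub_group_topology (G : groupType) (tau : Topological G) :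
  hausdorff_group_topology tau ->
  @open (markov G) `<=` @open (Topological.Pack tau).
Proof. by move=> htau U; apply. Qed.

Lemma topologies_coincide (G : preTopologicalGroupType) :
  hausdorff_group_topology (Topological.class G) ->
  @open G `<=` @open (zariski G) ->
  [/\ @open (zariski G) = @open (markov G) :> set_system G,
      @open (markov G) = @open G :> set_system G & a_minimal G].
Proof.
move=> hG GZ; have ZM := @zariski_sub_markov G.
have MG := @markov_sub_group_topology G _ hG.
split.
- by apply/seteqP; split=> // U /MG /GZ.
- by apply/seteqP; split=> // U /GZ /ZM.
- split=> // tau htau; apply: (subset_trans GZ); apply: (subset_trans ZM).
  exact: markov_sub_group_topology.
Qed.

Theorem theorem3p4 (d : Order.disp_t) (X : orderTopologicalType d)
    (X_compact : compact [set: X]) (X_connected : connected [set: X])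
    (H_itv_nontrivial : forall a b : X, (a < b)%O ->
      exists h : ohomeo (order_topology (closed_itv a b)), h <> 1%g) :
  [/\ [/\ @open (zariski (ohomeo X)) = @open (markov (ohomeo X))
            :> set_system (ohomeo X),
          @open (markov (ohomeo X)) = @open (ohomeo X)
            :> set_system (ohomeo X),
          @open (zariski (homeo X)) = @open (markov (homeo X))
            :> set_system (homeo X) &
          @open (markov (homeo X)) = @open (homeo X)
            :> set_system (homeo X)],
      a_minimal (ohomeo X) /\ a_minimal (homeo X) &
      aMplus_compact X /\ aM_compact X].
Proof.
have T2 := @order_hausdorff _ X.
have [ZM MH minH] :
  [/\ @open (zariski (homeo X)) = @open (markov (homeo X))
        :> set_system (homeo X),
     @open (markov (homeo X)) = @open (homeo X) :> set_system (homeo X)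
     & a_minimal (homeo X)].
  apply: topologies_coincide; first exact: homeo_group_topology.
  move=> U oU.
  have /continuousP := zariski_finer_compact_open X_connected H_itv_nontrivial
    (G := homeo X) (phi := id) (fun _ _ => erefl) (fun _ _ => id)
    (fun h _ => ex_intro _ h erefl).
  exact.
have [ZMo MHo minHo] :
  [/\ @open (zariski (ohomeo X)) = @open (markov (ohomeo X))
        :> set_system (ohomeo X),
     @open (markov (ohomeo X)) = @open (ohomeo X) :> set_system (ohomeo X)
     & a_minimal (ohomeo X)].
  apply: topologies_coincide; first exact: ohomeo_group_topology.
  move=> _ [U oU <-].
  have phi_surj (h : homeo X) : order_preserving h ->
      exists x : ohomeo X, ohomeo_val x = h.
    by move=> h_le; exists (exist _ h h_le).
  have /continuousP := zariski_finer_compact_open X_connected H_itv_nontrivial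
    (G := ohomeo X) (phi := @ohomeo_val _ X) (fun _ _ => erefl)
    val_inj phi_surj.
  exact.
by split.
Qed.
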